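(* Let $R$ be a Galois ring of odd characteristic which is not a field, and let $K\le R^\times$. Then the cyclotomic scheme $\mathrm{Cyc}(K,R)$ is normal if and only if $K$ is pure.
   Context: All rings have an identity. A finite local commutative ring $R$ with unique maximal ideal $\mathrm{rad}(R)$ and residue field of characteristic $p$ is a Galois ring if $\mathrm{rad}(R)=pR$. For a subgroup $K$ of $R^\times$, the cyclotomic scheme $\mathrm{Cyc}(K,R)$ is the pair $(R,\mathrm{Rel}(K,R))$, where $\mathrm{Rel}(K,R)$ is the set of binary relations $\{(x,y)\in R\times R:\ y-x\in rK\}$, $r\in R$. Its automorphism group $\mathrm{Aut}(\mathcal C)$ is the group of permutations $f$ of $R$ with $S^f=S$ for every $S\in\mathrm{Rel}(K,R)$. $\mathrm{A\Gamma L}_1(R)$ is the group of permutations $x\mapsto ax^\sigma+b$ with $a\in R^\times$, $b\in R$, $\sigma\in\mathrm{Aut}(R)$; the scheme is normal if $\mathrm{Aut}(\mathcal C)\le\mathrm{A\Gamma L}_1(R)$. A group $K\le R^\times$ is pure if the only ideal $I$ of $R$ with $K+I=K$ (equivalently $1+I\subseteq K$) is $I=\{0\}$. *)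

(* Defs.v *)
From HB Require Import structures.
From mathcomp Require Import all_boot all_order all_algebra all_fingroup.
Set Implicit Arguments. Unset Strict Implicit. Unset Printing Implicit Defensive.
Import GRing.Theory.
Local Open Scope ring_scope.

Section GaloisRingDefs.
Variable R : finComUnitRingType.

Definition is_ideal (I : {set R}) : Prop :=
  [/\ 0 \in I,
      (forall x y, x \in I -> y \in I -> x + y \in I) &
      (forall r x, x \in I -> r * x \in I)].

Definition is_maximal_ideal (M : {set R}) : Prop :=
  [/\ is_ideal M, (1 : R) \notin M &
      forall J : {set R}, is_ideal J -> M \subset J -> J = M \/ J = [set: R]].

(* R is a Galois ring: local with unique maximal ideal rad(R) = M,
   residue field R/M of characteristic p (p prime, p*1 in M), and M = pR *)
Definition galois_ring : Prop :=
  exists (M : {set R}) (p : nat),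
    [/\ is_maximal_ideal M,
        (forall M' : {set R}, is_maximal_ideal M' -> M' = M),
        prime p, (p%:R : R) \in M &
        M = [set (p%:R : R) * y | y : R]].

Definition ring_char_is (n : nat) : Prop :=
  [/\ (0 < n)%N, (n%:R : R) = 0 & forall m, (0 < m < n)%N -> (m%:R : R) != 0].

Definition odd_characteristic : Prop :=
  exists n, ring_char_is n /\ odd n.

Definition is_field_ring : Prop := forall x : R, x != 0 -> x \is a GRing.unit.

Definition is_ring_aut (s : R -> R) : Prop :=
  [/\ bijective s, (forall x y, s (x + y) = s x + s y),
      (forall x y, s (x * y) = s x * s y) & s 1 = 1].

Definition uset (K : {group {unit R}}) : {set R} := [set val k | k in K].

Definition coset_r (K : {group {unit R}}) (r : R) : {set R} :=
  [set r * x | x in uset K].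

Definition cyc_rel (K : {group {unit R}}) (r : R) (x y : R) : bool :=
  (y - x) \in coset_r K r.

Definition in_Aut_cyc (K : {group {unit R}}) (f : {perm R}) : Prop :=
  forall r : R,
    [set (f xy.1, f xy.2) | xy in [set xy : R * R | cyc_rel K r xy.1 xy.2]]
    = [set xy : R * R | cyc_rel K r xy.1 xy.2].

Definition in_AGammaL1 (f : R -> R) : Prop :=
  exists (a : R) (b : R) (s : R -> R),
    [/\ a \is a GRing.unit, is_ring_aut s & forall x, f x = a * s x + b].

Definition cyc_normal (K : {group {unit R}}) : Prop :=
  forall f : {perm R}, in_Aut_cyc K f -> in_AGammaL1 f.

Definition pure (K : {group {unit R}}) : Prop :=
  forall I : {set R}, is_ideal I ->
    [set k + i | k in uset K, i in I] = uset K -> I = [set 0].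

End GaloisRingDefs.

(* Main.v *)
(** If [f] is an automorphism of the scheme fixing 0 and 1, then
    [f y - f x] lies in [(y - x) K] for all [x], [y]; the point is that this
    forces [f] to be a ring automorphism when [K] is pure.  Let [F] be the
    residue field and [p^(n+1) = 0 <> p^n] in [R].  Taking [p]-th powers shows
    that for each [0 < j <= n] the residues of those [w] with [1 + p^j w] in [K]
    form a proper additive subgroup [V_j] of [F].  Comparing two related
    quotients modulo [V_j] yields, first, that for the permutation [g] of [F]
    induced by [f] all maps [u |-> 1 / (g y - g (y - 1/u))] are additive, so
    that [g] is a field automorphism (Hua), and then, by induction on [j], that
    the defect of additivity and the defect of multiplicativity of [f], if
    divisible by [p^j], have all their slopes in [V_j].  A function on [F] whose slopes all lie in a proper additive subgroup
    is affine, which kills both defects modulo [p^(j+1)].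

    Conversely, if [1 + I] is contained in [K] and [z <> 0] in [I] is killed by
    [p], translating by [z] the single residue class of 1 is an automorphism
    of the scheme, and it does not commute with [x |-> - x]. *)

From HB Require Import structures.
Require Import Defs.
From mathcomp Require Import all_boot all_order all_algebra all_fingroup all_field.
From mathcomp Require Import ring zify.
Set Implicit Arguments. Unset Strict Implicit. Unset Printing Implicit Defensive.
Import GRing.Theory.
Local Open Scope ring_scope.

(** * Polynomial functions on a finite field *)

Section FiniteField.
Variable F : finFieldType.

Lemma poly_eq0_card (P : {poly F}) (A : {set F}) :
  (size P <= #|A|)%N -> (forall x, x \in A -> P.[x] = 0) -> P = 0.
Proof.
move=> sP P0; apply: (@roots_geq_poly_eq0 _ P (enum A)); last by rewrite -cardE.
  by apply/allP => x; rewrite mem_enum => /P0/rootP.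
exact: enum_uniq.
Qed.

(** With q the cardinality of [F], the polynomial [1 - (X - a)^(q-1)] is 1 at a and 0 elsewhere. *)
Lemma interpolation (G : F -> F) :
  exists2 P : {poly F}, (size P <= #|F|)%N & forall x, P.[x] = G x.
Proof.
have q_gt0 : (0 < #|F|)%N by apply/card_gt0P; exists 0.
exists (\sum_a G a *: (1 - ('X - a%:P) ^+ (#|F|.-1))).
  apply: leq_trans (size_sum _ _ _) _; apply/bigmax_leqP => a _.
  apply: leq_trans (size_scale_leq _ _) _; apply: leq_trans (size_polyD _ _) _.
  by rewrite size_polyN size_exp_XsubC size_poly1 prednK // geq_max q_gt0 leqnn.
move=> x; rewrite horner_sum (bigD1 x) //= big1 => [|a nax].
  have -> : #|F| = #|F|.-2.+2 by have := finNzRing_gt1 F; case: #|F| => [|[|n]].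
  by rewrite !hornerE subrr exprS mul0r subr0 mulr1.
rewrite !hornerE.
have xa : x - a != 0 by rewrite subr_eq0 eq_sym.
suff -> : (x - a) ^+ #|F|.-1 = 1 by rewrite subrr mulr0.
by apply: (mulfI xa); rewrite -exprS prednK // expf_card mulr1.
Qed.

(** The leading terms cancel. This drives the induction on the degree in [affine_of_slopes] and the
    additivity of the annihilator of [V]. *)
Lemma size_shift_sub (P : {poly F}) s : (size (P \Po ('X + s%:P) - P)%R <= (size P).-1)%N.
Proof.
have [-> | P0] := eqVneq P 0; first by rewrite comp_poly0 subr0 size_poly0.
have sPs : size (P \Po ('X + s%:P)) = size P by rewrite size_comp_poly2 ?size_XaddC.
have lPs : lead_coef (P \Po ('X + s%:P)) = lead_coef P.
  by rewrite lead_coef_comp ?size_XaddC // lead_coefXaddC expr1n mulr1.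
have sP : size P = (size P).-1.+1 by rewrite prednK // lt0n size_poly_eq0.
apply/leq_sizeP => j; rewrite leq_eqVlt => /predU1P[<-|sj].
  by move: lPs; rewrite /lead_coef sPs coefB => ->; rewrite subrr.
by rewrite coefB !nth_default ?subrr ?sPs // sP.
Qed.

End FiniteField.

(** * Additive maps as polynomials in the powers [x ^+ (p ^ i)] *)

Section Additive.
Variables (F : finFieldType) (p : nat).
Hypothesis pF : p \in [pchar F].

Let p_pr : prime p := pcharf_prime pF.

Lemma expr_pcharI : injective (fun x : F => x ^+ p).
Proof. exact: (fmorph_inj (pFrobenius_aut pF)). Qed.

Lemma expr_pchar_expI i : injective (fun x : F => x ^+ (p ^ i)%N).
Proof.
elim: i => [|i IH] x y /=; first by rewrite !expr1.
by rewrite expnSr !exprM => /expr_pcharI/IH.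
Qed.

Lemma expr_pchar_expD i (x y : F) : (x + y) ^+ (p ^ i)%N = x ^+ (p ^ i)%N + y ^+ (p ^ i)%N.
Proof.
elim: i => [|i IH]; first by rewrite !expr1.
rewrite expnSr !exprM IH; exact: (pFrobenius_autD_comm pF (mulrC _ _)).
Qed.

Lemma expr_pchar_sum r (G : 'I_r -> F) : (\sum_(i < r) G i) ^+ p = \sum_(i < r) G i ^+ p.
Proof. exact: (rmorph_sum (pFrobenius_aut pF)). Qed.

Lemma card_pchar : #|F| = (p ^ logn p #|F|)%N.
Proof. exact: (card_pprimeChar pF). Qed.

Lemma expr_pchar_surj (x : F) : exists y, y ^+ p = x.
Proof.
have := injF_bij expr_pcharI.
by case=> h _ hK; exists (h x).
Qed.

(* If P is additive as a function, then P' takes equal values everywhere, so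
   P - P'(0) X is a polynomial in X^p, that is, the p-th power of another
   additive polynomial. *)
Lemma additive_poly r (P : {poly F}) :
  (p ^ r <= #|F|)%N -> (size P <= p ^ r)%N ->
  (forall x y, P.[x + y] = P.[x] + P.[y]) ->
  exists c : nat -> F, forall x, P.[x] = \sum_(i < r) c i * x ^+ (p ^ i)%N.
Proof.
elim: r P => [|r IH] P rF sP addP.
  exists (fun=> 0) => x; rewrite big_ord0.
  have P00 : P.[0] = 0 by apply: (addrI P.[0]); rewrite -addP !addr0.
  have sP1 : (size P <= 1)%N by [].
  by move: P00; rewrite (size1_polyC sP1) !hornerC.
set a := P^`().[0].
(* [P(X + s) - P - P(s)] vanishes at all points and has size at most #|F|, so it is zero as a
   polynomial and may be differentiated. *)
have derP s : P^`().[s] = a.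
  have E : P \Po ('X + s%:P) - P - (P.[s])%:P = 0.
    apply: (@poly_eq0_card _ _ setT).
      rewrite cardsT; apply: leq_trans rF.
      apply: leq_trans (size_polyD _ _) _; rewrite geq_max size_polyN.
      rewrite (leq_trans (size_polyC_leq1 _)) ?expn_gt0 ?prime_gt0 // andbT.
      apply: leq_trans (size_polyD _ _) _; rewrite geq_max size_polyN sP andbT.
      by rewrite size_comp_poly2 ?size_XaddC.
    by move=> y _; rewrite !hornerE horner_comp !hornerE addP; ring.
  have := congr1 (fun Q : {poly F} => Q^`().[0]) E.
  rewrite /= !derivE deriv_comp !derivE !hornerE horner_comp !hornerE.
  by rewrite subr0 => /eqP; rewrite subr_eq0 => /eqP.
have der0 : (P - a *: 'X)^`() = 0.
  apply: (@poly_eq0_card _ _ setT).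
    rewrite cardsT; apply: leq_trans rF; apply: leq_trans sP.
    apply/leq_sizeP => j sj.
    have [sP1|P1] := leqP (size P) 1.
      have [Pc] : P = (P`_0)%:P by apply: size1_polyC.
      have a0 : a = 0 by rewrite /a Pc derivC horner0.
      by rewrite a0 scale0r subr0 Pc derivC coef0.
    rewrite coef_deriv coefB coefZ coefX (leq_sizeP _ _ (leqnn _)) ?(leq_trans sj) //.
    by case: j sj => [|j] sj; rewrite ?mulr0 ?subr0 ?mul0rn //; move: P1; rewrite ltnNge (leq_trans sj).
  by move=> y _; rewrite derivB derivZ derivX !hornerE derP subrr.
have [b bE] : exists b : nat -> F, forall i, b i ^+ p = (P - a *: 'X)`_(p * i).
  have /fin_all_exists [b bE] : forall i : 'I_(size (P - a *: 'X)), exists y, y ^+ p = (P - a *: 'X)`_(p * i).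
    by move=> i; apply: expr_pchar_surj.
  exists (fun i => if insub i is Some j then b j else 0) => i.
  case: insubP => [j _ <- //|]; rewrite -leqNgt => si.
  rewrite expr0n (gtn_eqF (prime_gt0 p_pr)) nth_default //.
  by rewrite (leq_trans si) // leq_pmull // prime_gt0.
set H := \poly_(i < p ^ r) b i.
have HE x : P.[x] - a * x = H.[x] ^+ p.
  have -> : P.[x] - a * x = (P - a *: 'X).[x] by rewrite !hornerE.
  have sQ : (size (P - a *: 'X)%R <= p ^ r * p)%N.
    rewrite -expnSr; apply: leq_trans (size_polyD _ _) _.
    rewrite geq_max sP size_polyN; apply: leq_trans (size_scale_leq _ _) _.
    rewrite size_polyX expnS; apply: leq_trans (prime_gt1 p_pr) _.
    by rewrite leq_pmulr // expn_gt0 prime_gt0.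
  have -> : P - a *: 'X = (\poly_(i < p ^ r) (P - a *: 'X)`_(p * i)) \Po 'X^p.
    apply/polyP => k; rewrite coef_comp_poly_Xn ?prime_gt0 //.
    case: ifP => [/dvdnP[i ->]|pk].
      rewrite mulnK ?prime_gt0 // coef_poly [(p * i)%N]mulnC; case: ltnP => // ri.
      by rewrite nth_default // (leq_trans sQ) // leq_mul2r ri orbT.
    case: k pk => [|k] pk; first by rewrite dvdn0 in pk.
    have /eqP := coef_deriv (P - a *: 'X) k; rewrite der0 coef0 eq_sym -mulr_natr mulf_eq0.
    by rewrite -(dvdn_pcharf pF) pk orbF => /eqP.
  rewrite horner_comp hornerXn /H !horner_poly expr_pchar_sum.
  by apply: eq_bigr => i _; rewrite exprMn bE -!exprM mulnC.
have addH x y : H.[x + y] = H.[x] + H.[y].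
  apply: expr_pcharI => /=; rewrite -HE.
  have := expr_pchar_expD 1 H.[x] H.[y]; rewrite expn1 => ->.
  by rewrite -!HE addP; ring.
have sr : (p ^ r <= #|F|)%N.
  by apply: leq_trans rF; rewrite leq_exp2l // prime_gt1.
have [c cE] := IH H sr (size_poly _ _) addH.
exists (fun i => if i is i'.+1 then c i' ^+ p else a) => x.
rewrite big_ord_recl expn0 expr1 -[LHS](subrK (a * x)) HE addrC; congr (_ + _).
rewrite cE expr_pchar_sum; apply: eq_bigr => i _.
by rewrite exprMn /= /bump /= add1n expnSr exprM.
Qed.

Lemma additive_qpoly (g : F -> F) :
  (forall x y, g (x + y) = g x + g y) ->
  exists c : nat -> F, forall x, g x = \sum_(i < logn p #|F|) c i * x ^+ (p ^ i)%N.
Proof.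
move=> addg; have [P sP PE] := interpolation g.
have := @additive_poly (logn p #|F|) P; rewrite -card_pchar => /(_ (leqnn _) sP).
case=> [x y|c cE]; first by rewrite !PE.
by exists c => x; rewrite -PE.
Qed.
End Additive.

(** * Arithmetic of exponents: sums of two powers of p *)

Section SumOfPowers.
Variable p : nat.
Hypothesis p_gt2 : (2 < p)%N.

Let p_gt1 : (1 < p)%N. Proof. exact: ltnW. Qed.
Let p_gt0 : (0 < p)%N. Proof. exact: ltnW. Qed.

(** As p > 2, the smaller exponent is the p-adic valuation of the sum, even when both are equal, so
    the sum determines the unordered pair. The condition [a != b] excludes the crossed matching. *)
Lemma expn_add_inj a b c d : (p ^ a + p ^ d = p ^ c + p ^ b)%N -> a != b -> a = c /\ d = b.
Proof.
have dvd_sum u v w : (u <= v)%N -> (w <= u)%N -> (p ^ w %| p ^ u + p ^ v)%N.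
  by move=> uv wu; rewrite dvdn_add // dvdn_exp2l // (leq_trans wu).
have ndvd u v : (u <= v)%N -> ~~ (p ^ u.+1 %| p ^ u + p ^ v)%N.
  move=> uv; rewrite -(subnKC uv) expnD -{1}[(p ^ u)%N]muln1 -mulnDr expnSr.
  rewrite dvdn_pmul2l ?expn_gt0 ?p_gt0 //.
  case: (v - u)%N => [|k]; first by rewrite gtnNdvd.
  by rewrite dvdn_addl ?dvdn_exp // gtnNdvd.
have min_le u v u' v' : (u <= v)%N -> (u' <= v')%N ->
    (p ^ u + p ^ v = p ^ u' + p ^ v')%N -> (u' <= u)%N.
  by move=> uv uv' E; rewrite leqNgt; apply/negP => uu'; move: (ndvd _ _ uv); rewrite E dvd_sum.
have sorted_eq u v u' v' : (u <= v)%N -> (u' <= v')%N ->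
    (p ^ u + p ^ v = p ^ u' + p ^ v')%N -> u = u' /\ v = v'.
  move=> uv uv' E; have Eu : u = u'.
    by apply/eqP; rewrite eqn_leq (min_le _ _ _ _ uv' uv (esym E)) (min_le _ _ _ _ uv uv' E).
  subst u'; split=> //; move/addnI/eqP: E.
  by rewrite eqn_exp2l // => /eqP.
move=> E nab; have [ad|da] := leqP a d; have [cb|bc] := leqP c b.
- by have [] := sorted_eq _ _ _ _ ad cb E.
- move: E; rewrite [RHS]addnC => E.
  by have [ab _] := sorted_eq _ _ _ _ ad (ltnW bc) E; rewrite ab eqxx in nab.
- move: E; rewrite addnC => E.
  by have [dc ab] := sorted_eq _ _ _ _ (ltnW da) cb E; rewrite ab eqxx in nab.
- move: E; rewrite addnC [RHS]addnC => E.
  by have [] := sorted_eq _ _ _ _ (ltnW da) (ltnW bc) E.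
Qed.

(** The number with r base-p digits, all equal to 1; it serves to shift exponents in
    [additive_slopes]. *)
Definition repunit r := (\sum_(i < r) p ^ i)%N.

Lemma repunit_ge r (b : 'I_r) : (p ^ b <= repunit r)%N.
Proof. by rewrite /repunit (bigD1 b) //= leq_addr. Qed.

(** For p >= 3 the repunit is less than half of [p ^ r], and [p ^ a] is at most a third. *)
Lemma repunit_bound r (a : 'I_r) : (repunit r + p ^ a < p ^ r)%N.
Proof.
have p2 r' : (2 * repunit r' < p ^ r')%N.
  elim: r' => [|r' IH]; first by rewrite /repunit big_ord0.
  rewrite /repunit big_ord_recr /= -/(repunit r') mulnDr expnS.
  by have := leq_mul p_gt2 (leqnn (p ^ r')); lia.
have : (3 * p ^ a <= p ^ r)%N.
  apply: leq_trans (leq_mul p_gt2 (leqnn _)) _.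
  by rewrite -expnS leq_exp2l.
have := p2 r; have : (0 < p ^ a)%N by rewrite expn_gt0 p_gt0.
lia.
Qed.
End SumOfPowers.

(** * Functions whose slopes lie in a proper additive subgroup *)

Definition proper_subgroup (F : finFieldType) (V : {set F}) : Prop :=
  [/\ 0 \in V, (forall x y, x \in V -> y \in V -> x - y \in V) & exists a, a \notin V].

Section Slopes.
Variables (F : finFieldType) (V : {set F}).
Hypothesis Vsub : proper_subgroup V.

Let V0 : 0 \in V. Proof. by case: Vsub. Qed.
Let VB x y : x \in V -> y \in V -> x - y \in V.
Proof. by case: Vsub => _ H _; apply: H. Qed.
Let VN x : x \in V -> - x \in V.
Proof. by move=> /(VB V0); rewrite sub0r. Qed.
Let VD x y : x \in V -> y \in V -> x + y \in V.
Proof. by move=> Vx /VN; rewrite -[y in x + y]opprK; apply: VB. Qed.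

(** If x were nonzero, its multiples would exhaust [F]. This is the nondegeneracy of the pairing
    [x * t] modulo [V]. *)
Lemma proper_eq0 x : (forall t, t != 0 -> x * t \in V) -> x = 0.
Proof.
move=> Vx; apply/eqP; apply/negP => /negP x0.
have [_ _ [a aV]] := Vsub.
have [a0|a0] := eqVneq a 0; first by rewrite a0 V0 in aV.
by case/negP: aV; rewrite -(mulVKf x0 a) Vx // mulf_neq0 ?invr_eq0.
Qed.

(* The witness is prod_(v in V) (x - v): for fixed s, the polynomial
   L(X + s) - L(X) - L(s) has degree < #|V| and vanishes on V. *)
Lemma additive_annihilator : exists l : F -> F,
  [/\ forall x y, l (x + y) = l x + l y, (forall x, x \in V -> l x = 0) &
      exists a, l a != 0].
Proof.
pose L := \prod_(v in V) ('X - v%:P).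
have LE x : L.[x] = \prod_(v in V) (x - v).
  by rewrite horner_prod; apply: eq_bigr => v _; rewrite !hornerE.
have L0 x : (L.[x] == 0) = (x \in V).
  rewrite LE; apply/prodf_eq0/idP => [[v Vv]|Vx]; last by exists x; rewrite ?subrr.
  by rewrite subr_eq0 => /eqP ->.
exists (fun x => L.[x]); split=> [x y|x|].
- have sL : size L = #|V|.+1 by rewrite /L -big_enum size_prod_XsubC -cardE.
  suff : L \Po ('X + y%:P) - L - (L.[y])%:P = 0.
    move/(congr1 (fun P : {poly F} => P.[x])).
    rewrite !hornerE horner_comp !hornerE => /eqP.
    by rewrite -addrA -opprD subr_eq0 => /eqP.
  apply: (@poly_eq0_card _ _ V).
    apply: leq_trans (size_polyD _ _) _; rewrite geq_max size_polyN.
    apply/andP; split; first by have := size_shift_sub L y; rewrite sL.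
    by apply: leq_trans (size_polyC_leq1 _) _; apply/card_gt0P; exists 0.
  move=> v Vv; rewrite !hornerE horner_comp !hornerE.
  have /eqP -> : L.[v] == 0 by rewrite L0.
  rewrite subr0; apply/eqP; rewrite subr_eq0; apply/eqP.
  rewrite !LE (reindex_inj (addrI v)) /=; apply: eq_big => [w|w _]; last by ring.
  by apply/idP/idP => [/VB/(_ Vv)|/VD]; [rewrite addrC addKr | rewrite addrC; apply].
- by move=> Vx; apply/eqP; rewrite L0.
- by have [_ _ [a aV]] := Vsub; exists a; rewrite L0.
Qed.

(** An additive [l] killing [V] satisfies [l (g x / x) = 0] for x <> 0. With [l] and the powers of
    [g] written as additive polynomials, the coefficients of this identity force [g x ^+ (p ^ b)] to
    be a constant multiple of [x ^+ (p ^ b)] for some b; taking roots makes [g] linear. *)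
Lemma additive_slopes (g : F -> F) : (2%:R : F) != 0 ->
  (forall x y, g (x + y) = g x + g y) -> (forall d, d != 0 -> g d / d \in V) ->
  forall d, g d = g 1 * d.
Proof.
move=> two0 addg Vg d.
have [p p_pr pF] := finPcharP F.
have p_gt2 : (2 < p)%N.
  rewrite ltn_neqAle prime_gt1 // andbT; apply/eqP => p2.
  by move/pcharf0: pF two0; rewrite -p2 => ->; rewrite eqxx.
have [l [addl lV [a la]]] := additive_annihilator.
set r := logn p #|F|.
have [c cE] := additive_qpoly pF addl.
have /fin_all_exists [e eE] : forall b : 'I_r, exists e : nat -> F,
    forall x, g x ^+ (p ^ b)%N = \sum_(i < r) e i * x ^+ (p ^ i)%N.
  by move=> b; apply: (additive_qpoly pF) => x y; rewrite addg (expr_pchar_expD pF).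
have [b cb0] : exists b : 'I_r, c b != 0.
  apply/existsP; apply: contraR la => /existsPn c0.
  by rewrite cE big1 // => i _; have /negPn/eqP -> := c0 i; rewrite mul0r.
set N := repunit p r.
(* Q(x) = x^N l(g(x) / x) for x <> 0.  The shift by N makes all exponents
   nonnegative and less than #|F| - 1, and those with i <> j pairwise distinct. *)
pose Q : {poly F} := \sum_(j < r) \sum_(i < r) (c j * e j i) *: 'X^(N + p ^ i - p ^ j).
have p_gt0 : (0 < p)%N by apply: prime_gt0.
have Q0 : Q = 0.
  apply: (@poly_eq0_card _ _ [set~ 0]).
    rewrite cardsC1 (card_pchar pF) -/r.
    apply: leq_trans (size_sum _ _ _) _; apply/bigmax_leqP => j _.
    apply: leq_trans (size_sum _ _ _) _; apply/bigmax_leqP => i _.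
    apply: leq_trans (size_scale_leq _ _) _; rewrite size_polyXn.
    have := repunit_bound p_gt2 i; have := repunit_ge p j.
    have : (0 < p ^ j)%N by rewrite expn_gt0 p_gt0.
    by rewrite -/N; lia.
  move=> x; rewrite !inE => x0.
  have : l (g x / x) = 0 by apply/lV/Vg.
  rewrite cE => /(congr1 (fun z => x ^+ N * z)); rewrite mulr0 => <-.
  rewrite horner_sum mulr_sumr; apply: eq_bigr => j _.
  rewrite exprMn eE horner_sum mulr_suml !mulr_sumr; apply: eq_bigr => i _.
  rewrite !hornerE exprB ?unitfE //; last by rewrite (leq_trans (repunit_ge p j)) ?leq_addr.
  rewrite exprD exprVn /=; ring.
(* By [expn_add_inj] only the pair (i, b) contributes to the exponent [N + p ^ i - p ^ b], with
   coefficient [c b * e b i]. *)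
have e0 (i : 'I_r) : i != b -> e b i = 0.
  move=> nib; have := congr1 (fun P : {poly F} => P`_(N + p ^ i - p ^ b)) Q0.
  rewrite coef0 coef_sum (bigD1 b) //= [X in _ + X]big1 ?addr0 => [|j njb].
    rewrite coef_sum (bigD1 i) //= [X in _ + X]big1 ?addr0 => [|k nki].
      rewrite coefZ coefXn eqxx mulr1 => /eqP.
      by rewrite mulf_eq0 (negPf cb0) => /eqP.
    rewrite coefZ coefXn; case: eqP => [E|_]; last by rewrite mulr0.
    case/eqP: nki; apply/val_inj => /=.
    have := repunit_ge p b; rewrite -/N => Nb.
    by apply/eqP; rewrite -(eqn_exp2l _ _ (ltnW p_gt2)); apply/eqP; lia.
  rewrite coef_sum big1 // => k _; rewrite coefZ coefXn.
  case: eqP => [E|_]; last by rewrite mulr0.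
  have := repunit_ge p b; have := repunit_ge p j; rewrite -/N => Nj Nb.
  have [] := @expn_add_inj p p_gt2 i b k j; rewrite ?(inj_eq val_inj) //; first by lia.
  by move=> _ /val_inj jb; rewrite jb eqxx in njb.
have gE x : g x ^+ (p ^ b)%N = e b b * x ^+ (p ^ b)%N.
  by rewrite eE (bigD1 b) //= big1 ?addr0 // => i nib; rewrite e0 ?mul0r.
apply: (expr_pchar_expI pF) (b : nat) _ _ _ => /=.
by rewrite exprMn !gE expr1n mulr1.
Qed.

(* Induction on the degree: the difference of a polynomial function by s is
   affine, say of slope c_s; by symmetry c_s x = c_x s, so c_s = c_1 s for all
   s, and c_1 = 0 because V is proper.  Hence the function is additive up to a
   constant. *)
Lemma affine_of_slopes (G : F -> F) : (2%:R : F) != 0 ->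
  (forall x y, x != y -> (G y - G x) / (y - x) \in V) ->
  exists2 c, c \in V & forall x, G x = G 0 + c * x.
Proof.
move=> two0 VG.
have affP P : (forall x y, x != y -> (P.[y] - P.[x]) / (y - x) \in V) ->
    exists2 c, c \in V & forall x, P.[x] = P.[0] + c * x.
  move: {-1}(size P) (leqnn (size P)) => m; elim: m P => [|m IH] P sP VP.
    move: sP; rewrite size_poly_leq0 => /eqP ->.
    by exists 0 => // x; rewrite !hornerE.
  have /fin_all_exists2 [c Vc cE] : forall s, exists2 c, c \in V &
      forall x, P.[x + s] - P.[x] = P.[s] - P.[0] + c * x.
    move=> s; have [||c Vc cE] := IH (P \Po ('X + s%:P) - P).
    - by apply: leq_trans (size_shift_sub _ _) _; case: (size P) sP.
    - move=> x y xy; rewrite !hornerE !horner_comp !hornerE.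
      have -> : (P.[y + s] - P.[y] - (P.[x + s] - P.[x])) / (y - x) =
          (P.[y + s] - P.[x + s]) / ((y + s) - (x + s)) - (P.[y] - P.[x]) / (y - x).
        have -> : y + s - (x + s) = y - x by ring.
        by rewrite -mulrBl; congr (_ / _); ring.
      by apply: VB; apply: VP; rewrite // (inj_eq (addIr s)).
    exists c => // x; by have := cE x; rewrite !hornerE !horner_comp !hornerE => ->.
  have c_sym s : c s = c 1 * s.
    have := cE s 1; rewrite mulr1 => Es; apply: (addrI (P.[s] - P.[0])); rewrite -Es.
    by have /(canRL (subrK _)) := cE 1 s; rewrite [s + 1]addrC => ->; ring.
  have c0 s : c s = 0.
    by rewrite c_sym (_ : c 1 = 0) ?mul0r //; apply: proper_eq0 => t _; rewrite -c_sym.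
  pose g x := P.[x] - P.[0].
  have addg x y : g (x + y) = g x + g y.
    by have /(canRL (subrK _)) := cE y x; rewrite c0 mul0r addr0 /g => ->; ring.
  have Vg d : d != 0 -> g d / d \in V.
    by move=> d0; have := VP 0 d; rewrite subr0 eq_sym; apply.
  exists (g 1) => [|x]; first by rewrite -[g 1]divr1 Vg ?oner_eq0.
  by rewrite -(additive_slopes two0 addg Vg) /g [RHS]addrC subrK.
have [P _ PE] := interpolation G.
have [x y xy|c Vc cE] := affP P; first by rewrite !PE VG.
by exists c => // x; rewrite -!PE.
Qed.

(** If [f x = f y], the slopes towards a point z with [f z = f x - t^-1] put [(g x - g y) * t] in
    [V] for every t <> 0. Hence [g] factors through [f], and [affine_of_slopes] applies along a
    section of [f]. *)
Lemma affine_of_relative_slopes (T : finType) (f g : T -> F) : (2%:R : F) != 0 ->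
  (forall a, exists t, f t = a) ->
  (forall x y, f x != f y -> (g y - g x) / (f y - f x) \in V) ->
  exists c b, [/\ c \in V & forall x, g x = b + c * f x].
Proof.
move=> two0 /fin_all_exists [s fs] Vg.
have g_fib x y : f x = f y -> g x = g y.
  move=> fxy; apply/eqP; rewrite -subr_eq0; apply/eqP; apply: proper_eq0 => t t0.
  set z := s (f x - t^-1).
  have fz : f z = f x - t^-1 by apply: fs.
  have fzx : f z != f x by rewrite fz -subr_eq0 addrAC subrr sub0r oppr_eq0 invr_eq0.
  have -> : (g x - g y) * t = (g x - g z) / (f x - f z) - (g y - g z) / (f y - f z).
    by rewrite -fxy fz opprB [_ + (_ - _)]addrC subrK invrK; ring.
  by apply: VB; apply: Vg; rewrite -?fxy.
have [x y xy|c Vc cE] := affine_of_slopes (G := g \o s) two0.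
  by have := Vg (s x) (s y); rewrite !fs; apply.
exists c, (g (s 0)); split=> // x.
by rewrite -cE /=; apply: g_fib; rewrite fs.
Qed.

(* For fixed y, the nondegenerate pairing (w, u) |-> w u mod V makes
   u |-> 1 / (f y - f (y - 1/u)) adjoint to the inverse of h, hence additive.
   Comparing at u and 2u shows that f preserves midpoints; additivity of
   u |-> 1 / f(1/u) then gives f(a(a+1)) = f(a)(f(a)+1), as in Hua's theorem. *)
Lemma ring_hom_of_adjoint (f : F -> F) : (2%:R : F) != 0 ->
  injective f -> f 0 = 0 -> f 1 = 1 ->
  (forall y, exists h : F -> F, (forall a, exists w, h w = a) /\
     forall w x, x != y -> h w / (f y - f x) - w / (y - x) \in V) ->
  (forall x y, f (x + y) = f x + f y) /\ (forall x y, f (x * y) = f x * f y).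
Proof.
move=> two0 f_inj f0 f1 Hf.
pose rho y u := if u == 0 then 0 else (f y - f (y - u^-1))^-1.
have rhoD y u v : rho y (u + v) = rho y u + rho y v.
  have [h [h_surj Vh]] := Hf y.
  have Vr w z : h w * rho y z - w * z \in V.
    rewrite /rho; case: eqVneq => [->|z0]; first by rewrite !mulr0 subr0.
    have := Vh w (y - z^-1); rewrite opprB [_ + (_ - _)]addrC subrK invrK; apply.
    by rewrite -subr_eq0 addrAC subrr sub0r oppr_eq0 invr_eq0.
  apply/eqP; rewrite -subr_eq0; apply/eqP; apply: proper_eq0 => t _.
  have [w <-] := h_surj t.
  have := VB (VB (Vr w (u + v)) (Vr w u)) (Vr w v); congr (_ \in V); ring.
have rhoE y x : x != y -> rho y (y - x)^-1 = (f y - f x)^-1.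
  move=> xy; rewrite /rho invr_eq0 subr_eq0 eq_sym (negPf xy) invrK.
  by rewrite opprB [_ + (_ - _)]addrC subrK.
have fB_neq0 x y : x != y -> f y - f x != 0.
  by move=> xy; rewrite subr_eq0 (inj_eq f_inj) eq_sym.
have f_mid x y : f ((x + y) / 2%:R) = (f x + f y) / 2%:R.
  have [->|xy] := eqVneq x y.
    have dbl (z : F) : (z + z) / 2%:R = z by field.
    by rewrite !dbl.
  have mE : y - (x + y) / 2%:R = (y - x) / 2%:R by field.
  have my : (x + y) / 2%:R != y.
    by rewrite -subr_eq0 -oppr_eq0 opprB mE mulf_neq0 ?invr_eq0 // subr_eq0 eq_sym.
  have E : (f y - f ((x + y) / 2%:R))^-1 = (f y - f x)^-1 + (f y - f x)^-1.
    by rewrite -(rhoE _ _ my) mE invf_div mulr_natl mulr2n rhoD rhoE.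
  have {}E : f y - f ((x + y) / 2%:R) = (f y - f x) / 2%:R.
    by rewrite -[LHS]invrK E; field; rewrite fB_neq0 // two0.
  by rewrite -[LHS](subKr (f y)) E; field.
have fD x y : f (x + y) = f x + f y.
  have half z : f (z / 2%:R) = f z / 2%:R.
    by have := f_mid z 0; rewrite f0 !addr0.
  by apply: (mulIf (invr_neq0 two0)); rewrite -half f_mid.
have fN x : f (- x) = - f x by apply/eqP; rewrite -addr_eq0 -fD addNr f0.
split=> //.
have f_neq0 x : x != 0 -> f x != 0 by rewrite -{2}f0 (inj_eq f_inj).
have fsucc a : f (a * (a + 1)) = f a * (f a + 1).
  have [->|a0] := eqVneq a 0; first by rewrite mul0r f0 mul0r.
  have [a1|a1] := eqVneq (a + 1) 0.
    by rewrite a1 mulr0 f0 -[X in f a + X]f1 -fD a1 f0 mulr0.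
  have rho0 z : z != 0 -> rho 0 z^-1 = - (f (- z)) ^-1.
    by move=> z0; have := rhoE 0 (- z); rewrite oppr_eq0 opprK add0r f0 sub0r invrN; apply.
  (* These two arguments add up to 1/a. *)
  have := rhoD 0 (a * (a + 1))^-1 (a + 1)^-1.
  have -> : (a * (a + 1))^-1 + (a + 1)^-1 = a^-1 by field; rewrite a0.
  rewrite !rho0 ?mulf_neq0 // !fN !invrN !opprK => E.
  have fa1 : f a + 1 != 0 by rewrite -f1 -fD f_neq0.
  have -> : f (a * (a + 1)) = ((f a)^-1 - (f (a + 1))^-1)^-1 by rewrite E addrK invrK.
  rewrite fD f1.
  have fa : f a + 1 + -1 * f a = 1 by ring.
  by field; rewrite fa fa1 f_neq0 ?oner_eq0.
have f_sq a : f (a * a) = f a * f a.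
  by have := fsucc a; rewrite !mulrDr !mulr1 fD => /addIr.
move=> x y; apply: (mulfI two0).
have -> : 2%:R * f (x * y) = f ((x + y) * (x + y)) - f x * f x - f y * f y.
  have -> : (x + y) * (x + y) = x * x + x * y + (x * y + y * y) by ring.
  by rewrite !fD !f_sq; ring.
by rewrite f_sq fD; ring.
Qed.
End Slopes.

(** * The residue ring as a finite field *)

Section ResidueField.
Local Open Scope quotient_scope.
Variables (R : finComUnitRingType) (M : {set R}).
Hypothesis M_sub : forall x y, x \in M -> y \in M -> x - y \in M.
Hypothesis M_mul : forall r x, x \in M -> r * x \in M.
Hypothesis unit_notin : forall x : R, (x \is a GRing.unit) = (x \notin M).

Definition res_ideal : {pred R} := mem M.

Lemma res_ideal_closed : idealr_closed res_ideal.
Proof.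
have M1 : (1 : R) \notin M by rewrite -unit_notin unitr1.
have M0 : 0 \in M by apply: contraNT M1; rewrite -unit_notin unitr0.
split=> // a x y Mx My; rewrite -[y]opprK; apply: M_sub; first exact: M_mul.
by rewrite -sub0r; apply: M_sub.
Qed.

HB.instance Definition _ := isIdealr.Build R res_ideal res_ideal_closed.

Definition res_ring := {ideal_quot res_ideal}.
HB.instance Definition _ := GRing.ComNzRing.on res_ring.

Local Notation proj := (\pi_res_ring : R -> res_ring).

HB.instance Definition _ :=
  Choice_isCountable.Build res_ring (pcan_pickleK (can_pcan (@reprK _ res_ring))).

Lemma res_enumP : Finite.axiom (undup [seq proj x | x : R]).
Proof.
apply: Finite.uniq_enumP; first exact: undup_uniq.
by move=> q; rewrite mem_undup; apply/mapP; exists (generic_quotient.repr q); rewrite ?mem_enum ?reprK.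
Qed.

HB.instance Definition _ := isFinite.Build res_ring res_enumP.

Lemma proj_eq0 x : (proj x == 0) = (x \in M).
Proof. by rewrite -(rmorph0 proj) -[proj x == _]Quotient.idealrBE subr0. Qed.

Definition res_inv (q : res_ring) : res_ring := proj (generic_quotient.repr q)^-1.

Lemma res_mulVf q : q != 0 -> res_inv q * q = 1.
Proof.
rewrite -{1 3}[q]reprK proj_eq0 -unit_notin => uq.
by rewrite /res_inv -rmorphM mulVr // rmorph1.
Qed.

(** A representative of 0 is a non-unit, and the inverse of a non-unit is by convention itself. *)
Lemma res_inv0 : res_inv 0 = 0.
Proof.
rewrite /res_inv invr_out ?reprK // unit_notin negbK.
by rewrite -proj_eq0 reprK.
Qed.

HB.instance Definition _ := GRing.ComNzRing_isField.Build res_ring res_mulVf res_inv0.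

Lemma residue_field : exists (F : finFieldType) (f : {rmorphism R -> F}),
  (forall a, exists x, f x = a) /\ forall x, (f x == 0) = (x \in M).
Proof.
exists res_ring, proj; split; last exact: proj_eq0.
by move=> a; exists (generic_quotient.repr a); apply: reprK.
Qed.
End ResidueField.

(** The inner binomial coefficients are divisible by p. The linear term stands apart because for x
    divisible by p it alone decides the next p-adic level. *)
Lemma expr_prime_expand (R : comNzRingType) p (x : R) : prime p -> exists s,
  (1 + x) ^+ p = 1 + p%:R * x + p%:R * (x ^+ 2 * s) + x ^+ p.
Proof.
move=> p_pr; have := prime_gt1 p_pr; case: p p_pr => [|[|m]] // p_pr _.
exists (\sum_(i < m) x ^+ i *+ ('C(m.+2, i.+2) %/ m.+2)).
rewrite exprDn big_ord_recr /= subnn expr0 mul1r binn mulr1n; congr (_ + _).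
rewrite !big_ord_recl /= bin0 !expr1n expr0 mul1r mulr1n bin1 !mul1r expr1.
rewrite addrA -mulr_natl; congr (_ + _); rewrite !mulr_sumr; apply: eq_bigr => i _.
have -> : bump 0 (bump 0 i) = i.+2 by [].
have /divnK {1}<- : (m.+2 %| 'C(m.+2, i.+2))%N by rewrite prime_dvd_bin //= !ltnS.
rewrite expr1n mul1r mulrnA mulr_natl mulrnAr.
by rewrite -(exprD x 2 i).
Qed.

(** * The p-adic layers of [K] *)

Section GaloisRing.
Variables (R : finComUnitRingType) (K : {group {unit R}}).

Lemma uset1 : 1 \in uset K.
Proof. by apply/imsetP; exists 1%g; rewrite ?group1. Qed.

Lemma usetM x y : x \in uset K -> y \in uset K -> x * y \in uset K.
Proof.
by move=> /imsetP[k Kk ->] /imsetP[l Kl ->]; apply/imsetP; exists (k * l)%g; rewrite ?groupM.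
Qed.

Lemma usetV x : x \in uset K -> x^-1 \in uset K.
Proof.
by move=> /imsetP[k Kk ->]; apply/imsetP; exists (k^-1)%g; rewrite ?groupV.
Qed.

Lemma usetX x n : x \in uset K -> x ^+ n \in uset K.
Proof. by move=> Kx; elim: n => [|n IH]; rewrite ?expr0 ?uset1 // exprS usetM. Qed.

Lemma uset_unit x : x \in uset K -> x \is a GRing.unit.
Proof. by move=> /imsetP[k _ ->]; apply: (valP k). Qed.

Variables (p n : nat) (F : finFieldType) (pi : {rmorphism R -> F}).
Hypothesis (p_pr : prime p) (p_odd : odd p) (n_gt0 : (0 < n)%N).
Hypothesis pi_surj : forall a, exists x, pi x = a.
Hypothesis pi_unit : forall x, (x \is a GRing.unit) = (pi x != 0).
Hypothesis pi_ker : forall x, pi x = 0 -> exists y, x = p%:R * y.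
Hypothesis pn0 : (p%:R : R) ^+ n.+1 = 0.
Hypothesis pn1 : (p%:R : R) ^+ n != 0.

Local Notation P := (p%:R : R).

Lemma pi_p : pi P = 0.
Proof.
apply/eqP; rewrite -[_ == 0]negbK -pi_unit; apply/negP => /(unitrX n.+1).
by rewrite pn0 unitr0.
Qed.

Lemma res_two0 : (2%:R : F) != 0.
Proof.
apply/eqP => two0; have := pi_p; rewrite rmorph_nat -(odd_double_half p) p_odd.
by rewrite natrD -muln2 natrM two0 mulr0 addr0 => /eqP; rewrite oner_eq0.
Qed.

Lemma pi_pX j x : (0 < j)%N -> pi (P ^+ j * x) = 0.
Proof. by case: j => // j _; rewrite exprS !rmorphM /= pi_p !mul0r. Qed.

Lemma pi_1pX j x : (0 < j)%N -> pi (1 + P ^+ j * x) = 1.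
Proof. by move=> j0; rewrite rmorphD rmorph1 /= pi_pX // addr0. Qed.

Lemma unit_1pX j x : (0 < j)%N -> 1 + P ^+ j * x \is a GRing.unit.
Proof. by move=> j0; rewrite pi_unit pi_1pX // oner_eq0. Qed.

(** Otherwise x - y would be a unit killed by [P ^+ j], contradicting [pn1]. Thus a multiple of
    [P ^+ j] has a well-defined residue at level j. *)
Lemma pi_eq j x y : (j <= n)%N -> P ^+ j * x = P ^+ j * y -> pi x = pi y.
Proof.
move=> jn E; apply/eqP; rewrite -subr_eq0 -rmorphB -[_ == 0]negbK -pi_unit.
apply: contra pn1 => u; rewrite -(subnK jn) exprD; apply/eqP/(mulIr u).
by rewrite mul0r -mulrA mulrBr E subrr mulr0.
Qed.

Lemma pX_eq j x y : pi x = pi y -> exists z, P ^+ j * x = P ^+ j * y + P ^+ j.+1 * z.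
Proof.
move=> xy; have [|z zE] := @pi_ker (x - y); first by rewrite rmorphB xy subrr.
by exists z; rewrite exprSr -mulrA -zE; ring.
Qed.

(** The graded piece V_j of the filtration of [K] by its intersections with 1 + p^j R. *)
Definition layer j : {set F} := [set pi w | w in [set w | 1 + P ^+ j * w \in uset K]].

Lemma layer_quotient j a b k : (0 < j)%N -> k \in uset K ->
  1 + P ^+ j * a = (1 + P ^+ j * b) * k -> pi a - pi b \in layer j.
Proof.
move=> j0 Kk E; have ub := unit_1pX b j0.
apply/imsetP; exists ((a - b) / (1 + P ^+ j * b)); last first.
  by rewrite rmorph_div //= pi_1pX // divr1 rmorphB.
rewrite inE; suff -> : 1 + P ^+ j * ((a - b) / (1 + P ^+ j * b)) = k by [].
apply: (mulrI ub); rewrite -E mulrDr mulr1 mulrCA [_ * (_ / _)]mulrC divrK //.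
by ring.
Qed.

(** Dividing the second relation by the first leaves [1 + P ^+ j * (c / A) = (1 + P ^+ j * (c' /
    A')) * (l / k)]. All later slope conditions come from this comparison. *)
Lemma layer_rel j A A' c c' k l : (0 < j)%N -> k \in uset K -> l \in uset K ->
  A' \is a GRing.unit -> A = A' * k -> A + P ^+ j * c = (A' + P ^+ j * c') * l ->
  pi c / pi A - pi c' / pi A' \in layer j.
Proof.
move=> j0 Kk Kl uA' AE E; have uk := uset_unit Kk.
have uA : A \is a GRing.unit by rewrite AE unitrM uA'.
rewrite -!rmorph_div //; apply: (layer_quotient j0 (usetM Kl (usetV Kk))).
apply: (mulrI uA); rewrite mulrDr mulr1 mulrCA [A * (_ / _)]mulrC divrK // E AE.
have -> : (A' + P ^+ j * c') = A' * (1 + P ^+ j * (c' / A')).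
  by rewrite mulrDr mulr1 mulrCA [A' * (_ / _)]mulrC divrK.
set B := 1 + _; have -> : A' * k * (B * (l / k)) = A' * B * l * (k / k) by ring.
by rewrite divrr ?mulr1.
Qed.

(* If 1 + p^j R is contained in K (1 + p^(j+1) R), then taking p-th powers
   raises j by one, and purity fails when j = n is reached. *)
Lemma layer_proper j : pure K -> (0 < j <= n)%N -> proper_subgroup (layer j).
Proof.
move=> pureK /andP[j0 jn]; split.
- by apply/imsetP; exists 0; rewrite ?inE ?mulr0 ?addr0 ?uset1 ?rmorph0.
- move=> _ _ /imsetP[a Ka ->] /imsetP[b Kb ->].
  rewrite !inE in Ka Kb; apply: (@layer_quotient _ _ _ ((1 + P ^+ j * b)^-1 * (1 + P ^+ j * a))).
  - exact: j0.
  - by rewrite usetM ?usetV.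
  by rewrite mulVKr ?(uset_unit Kb).
apply/existsP; rewrite -negb_forall; apply/negP => /forallP full.
have fullP : forall i, (j + i <= n)%N -> forall a, a \in layer (j + i).
  elim=> [|i IH] jin a; first by rewrite addn0.
  have /imsetP[w] := IH (leq_trans (leq_add (leqnn j) (leqnSn i)) jin) a.
  rewrite inE => Kw ->; set m := (j + i)%N in IH Kw *.
  have m0 : (0 < m)%N by rewrite addn_gt0 j0.
  have [s sE] := expr_prime_expand (P ^+ m * w) p_pr.
  (* Since p >= 3 and m >= 1, the term [x ^+ p] lies at level m + 2 or higher, so only [P * x]
     affects the residue at level m + 1. *)
  have [e pE] : exists e, (m * p = m.+1 + e.+1)%N.
    by exists (m * p - m.+2)%N; have := odd_prime_gt2 p_odd p_pr; nia.
  apply/imsetP; exists (w + P ^+ m * (w ^+ 2 * s) + P ^+ e.+1 * w ^+ p).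
    rewrite inE addnS -/m (_ : 1 + _ = (1 + P ^+ m * w) ^+ p) ?usetX //.
    by rewrite sE [(_ * _) ^+ p]exprMn -[(P ^+ m) ^+ p]exprM pE exprD !exprS; ring.
  by rewrite !rmorphD /= !pi_pX // !addr0.
(* At level n residues suffice, because [P ^+ n.+1] is 0. *)
have Kn w : 1 + P ^+ n * w \in uset K.
  have := fullP (n - j)%N; rewrite subnKC // => /(_ (leqnn _) (pi w))/imsetP[w']; rewrite inE => Kw' ww'.
  by have [z ->] := pX_eq n ww'; rewrite pn0 mul0r addr0.
case/eqP: pn1.
have I0 : [set P ^+ n * w | w : R] = [set 0].
  apply: pureK; first split.
  - by apply/imsetP; exists 0; rewrite ?mulr0.
  - move=> _ _ /imsetP[x _ ->] /imsetP[y _ ->]; apply/imsetP.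
    by exists (x + y); rewrite ?mulrDr.
  - by move=> r _ /imsetP[x _ ->]; apply/imsetP; exists (r * x); rewrite // mulrCA.
  apply/setP => x; apply/imset2P/idP => [[k _ Kk /imsetP[w _ ->] ->]|Kx].
    have -> : k + P ^+ n * w = k * (1 + P ^+ n * (k^-1 * w)).
      by rewrite mulrDr mulr1 mulrCA mulVKr ?(uset_unit Kk).
    by rewrite usetM.
  by exists x 0; rewrite ?addr0 //; apply/imsetP; exists 0; rewrite ?mulr0.
apply/set1P; rewrite -I0; apply/imsetP; exists 1; rewrite ?mulr1 //.
Qed.

(** * Scheme automorphisms fixing 0 and 1 are ring automorphisms *)

Hypothesis pureK : pure K.
Variable f : R -> R.
Hypothesis fK : forall x y, exists2 k, k \in uset K & f y - f x = (y - x) * k.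
Hypothesis f0 : f 0 = 0.
Hypothesis f1 : f 1 = 1.

Lemma rel_inj : injective f.
Proof.
move=> x y fxy; have [k Kk] := fK y x; rewrite fxy subrr => E.
by apply/eqP; rewrite -subr_eq0; apply/eqP/(mulIr (uset_unit Kk)); rewrite -E mul0r.
Qed.

Lemma rel_uset x : exists2 k, k \in uset K & f x = x * k.
Proof. by have := fK 0 x; rewrite f0 !subr0. Qed.

Lemma rel_unit x y : (f y - f x \is a GRing.unit) = (y - x \is a GRing.unit).
Proof. by have [k Kk ->] := fK x y; rewrite unitrM (uset_unit Kk) andbT. Qed.

(** Residues agree exactly when the difference is a non-unit, and a factor from [K] does not change
    that. *)
Lemma pi_rel_eq x y : (pi (f x) == pi (f y)) = (pi x == pi y).
Proof.
have E (g : R -> R) : (pi (g x) == pi (g y)) = ~~ (g x - g y \is a GRing.unit).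
  by rewrite pi_unit negbK rmorphB subr_eq0.
by rewrite E rel_unit -(E id).
Qed.

(** Adding [P ^+ n * w] to [s a] adds [P ^+ n * (w * k)] to its image, with k in [K]. Comparing the
    differences from [s b] before and after, by [layer_rel], makes w |-> [pi (w * k)] the map h
    required by [ring_hom_of_adjoint]. *)
Lemma res_hom : [/\ forall a, exists x, pi (f x) = a,
  forall x y, pi (f (x + y)) = pi (f x) + pi (f y) &
  forall x y, pi (f (x * y)) = pi (f x) * pi (f y)].
Proof.
have [s sE] := fin_all_exists pi_surj.
pose fb a := pi (f (s a)).
have fbE x : fb (pi x) = pi (f x) by apply/eqP; rewrite pi_rel_eq sE.
have fb_inj : injective fb.
  by move=> a b /eqP; rewrite pi_rel_eq !sE => /eqP.
have fb0 : fb 0 = 0 by rewrite -(rmorph0 pi) fbE f0.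
have fb1 : fb 1 = 1 by rewrite -(rmorph1 pi) fbE f1 rmorph1.
have Vn : proper_subgroup (layer n) by apply: layer_proper; rewrite ?n_gt0 /=.
have adj a : exists h : F -> F, (forall b, exists w, h w = b) /\
    forall w b, b != a -> h w / (fb a - fb b) - w / (a - b) \in layer n.
  have /fin_all_exists2 [k Kk kE] : forall w, exists2 k, k \in uset K &
      f (s a + P ^+ n * s w) - f (s a) = P ^+ n * (s w * k).
    move=> w; have [k Kk kE] := fK (s a) (s a + P ^+ n * s w).
    by exists k => //; rewrite kE addrC addKr mulrA.
  exists (fun w => pi (s w * k w)); split.
    (* By [pn0] a residue determines the multiple of [P ^+ n], so injectivity of [f] gives that of
       h, and finiteness of [F] gives surjectivity. *)
    have h_inj : injective (fun w => pi (s w * k w)).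
      move=> w w' /(pX_eq n) [z]; rewrite pn0 mul0r addr0 -!kE.
      by move=> /addIr/rel_inj/addrI/(pi_eq (leqnn n)); rewrite !sE.
    by move=> b; have [g _ gK] := injF_bij h_inj; exists (g b).
  move=> w b ba; have [l Kl lE] := fK (s b) (s a).
  have [m Km mE] := fK (s b) (s a + P ^+ n * s w).
  have := @layer_rel n _ _ (s w * k w) (s w) l m n_gt0 Kl Km _ lE.
  rewrite !rmorphB !sE; apply.
    by rewrite pi_unit rmorphB !sE subr_eq0 eq_sym.
  rewrite -kE -[s a - s b + _]addrAC -mE; ring.
have [fbD fbM] := ring_hom_of_adjoint Vn res_two0 fb_inj fb0 fb1 adj.
split=> [a|x y|x y]; last 2 first.
- by rewrite -!fbE rmorphD fbD.
- by rewrite -!fbE rmorphM fbM.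
by have [g _ gK] := injF_bij fb_inj; exists (s (g a)); apply: gK.
Qed.

Lemma pi_rel1 : pi (f 1) = 1. Proof. by rewrite f1 rmorph1. Qed.

(** Comparing [f w - f u] with [f (w + v) - f (u + v)] makes the defect [d (u, v)] affine in
    [pi (f u)], with slope c_v in V_j and no constant term. By symmetry c_v = c_1 [pi (f v)]; since
    these slopes fill the line through c_1 and V_j is proper, c_1 = 0. *)
Lemma additive_step j : (0 < j <= n)%N ->
  (forall x y, exists d, f (x + y) = f x + f y + P ^+ j * d) ->
  forall x y, exists d, f (x + y) = f x + f y + P ^+ j.+1 * d.
Proof.
move=> j0n addj x y; have [j0 jn] := andP j0n.
have [phi_surj phiD phiM] := res_hom.
have Vj := layer_proper pureK j0n.
have /fin_all_exists [d dE] : forall u : R * R, exists d, f (u.1 + u.2) = f u.1 + f u.2 + P ^+ j * d.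
  by move=> u; apply: addj.
have dC u v : pi (d (u, v)) = pi (d (v, u)).
  apply: (pi_eq jn); apply: (addrI (f u + f v)).
  by rewrite -(dE (u, v)) addrC (dE (v, u)) [f v + _]addrC.
have /fin_all_exists [c cE] : forall v, exists c, c \in layer j /\ forall u, pi (d (u, v)) = c * pi (f u).
  move=> v; have [|c [b [Vc cE]]] :=
      affine_of_relative_slopes Vj (f := pi \o f) (g := fun u => pi (d (u, v))) res_two0 phi_surj.
    move=> u w uw /=; have [k Kk kE] := fK u w; have [l Kl lE] := fK (u + v) (w + v).
    have := @layer_rel j _ (w - u) (d (w, v) - d (u, v)) 0 k l j0 Kk Kl _ kE.
    rewrite !rmorphB rmorph0 mul0r subr0; apply.
      by rewrite -rel_unit pi_unit rmorphB subr_eq0 eq_sym.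
    rewrite mulr0 addr0 [w - u](_ : _ = w + v - (u + v)); last by ring.
    by rewrite -lE (dE (w, v)) (dE (u, v)) /=; ring.
  exists c; split=> // u; rewrite cE /=; suff -> : b = 0 by rewrite add0r.
  have := cE 0; rewrite /= f0 rmorph0 mulr0 addr0 => <-.
  rewrite -(rmorph0 pi); apply: (pi_eq jn); rewrite mulr0.
  by have := dE (0, v); rewrite /= add0r f0 add0r -[LHS]addr0 => /addrI <-.
have c1 v : c v = c 1 * pi (f v).
  by rewrite -[LHS]mulr1 -pi_rel1 -(cE v).2 dC (cE 1).2.
have c10 : c 1 = 0.
  apply: (proper_eq0 Vj) => t _; have [v <-] := phi_surj t.
  by rewrite -c1; case: (cE v).
have [|z zE] := @pi_ker (d (x, y)); first by rewrite (cE y).2 c1 c10 !mul0r.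
by exists z; rewrite (dE (x, y)) /= zE exprSr mulrA.
Qed.

(** For a unit x, comparing [f x * f (v - u)] with [f (x * (v - u))] makes the defect, divided by
    [pi (f x)], affine in [pi (f u)]. It vanishes at u = 0 and u = 1, hence everywhere. *)
Lemma multiplicative_step j : (0 < j <= n)%N -> (forall x y, f (x + y) = f x + f y) ->
  (forall x y, exists d, f (x * y) = f x * f y + P ^+ j * d) ->
  forall x y, exists d, f (x * y) = f x * f y + P ^+ j.+1 * d.
Proof.
move=> j0n fD mulj; have [j0 jn] := andP j0n.
have [phi_surj phiD phiM] := res_hom.
have Vj := layer_proper pureK j0n.
have fN z : f (- z) = - f z by apply/eqP; rewrite -addr_eq0 -fD addNr f0.
have unit_case x y : x \is a GRing.unit -> exists d, f (x * y) = f x * f y + P ^+ j.+1 * d.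
  move=> ux; have /fin_all_exists [d dE] := mulj x.
  have [k Kk kE] := rel_uset x.
  have ufx : f x \is a GRing.unit by rewrite kE unitrM ux (uset_unit Kk).
  have dB u v : pi (d (u - v)) = pi (d u) - pi (d v).
    rewrite -rmorphB; apply: (pi_eq jn); rewrite mulrBr.
    have E w : P ^+ j * d w = f (x * w) - f x * f w by rewrite dE addrC addKr.
    by rewrite !E mulrBr !fD !fN; ring.
  have [|c [b [Vc cE]]] := affine_of_relative_slopes Vj (f := pi \o f)
      (g := fun u => pi (d u) / pi (f x)) res_two0 phi_surj.
    move=> u v uv /=; have [l Kl lE] := rel_uset (v - u).
    have [m Km mE] := rel_uset (x * (v - u)).
    rewrite -mulrBl -mulrA -invfM.
    have := @layer_rel j (f x * f (v - u)) (x * (v - u)) (d (v - u)) 0 _ m j0 (usetM Kk Kl) Km.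
    rewrite rmorph0 mul0r subr0 rmorphM dB /= [pi (f (v - u))](_ : _ = pi (f v) - pi (f u)).
      apply.
      - by rewrite unitrM ux -rel_unit pi_unit rmorphB subr_eq0 eq_sym.
      - by rewrite kE lE; ring.
      by rewrite mulr0 addr0 -mE dE.
    by rewrite fD fN rmorphB.
  have d0 u : P ^+ j * d u = 0 -> pi (d u) = 0.
    by move=> E; rewrite -(rmorph0 pi); apply: (pi_eq jn); rewrite E mulr0.
  have b0 : b = 0.
    have := cE 0; rewrite /= f0 rmorph0 mulr0 addr0 => <-; rewrite d0 ?mul0r //.
    by have := dE 0; rewrite mulr0 f0 mulr0 add0r => <-.
  have c0 : c = 0.
    have := cE 1; rewrite /= b0 pi_rel1 mulr1 add0r => <-; rewrite d0 ?mul0r //.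
    by apply: (addrI (f x)); have := dE 1; rewrite !mulr1 f1 mulr1 addr0 => <-.
  have [|z zE] := @pi_ker (d y).
    have := cE y; rewrite b0 c0 mul0r addr0 => /eqP.
    by rewrite mulf_eq0 invr_eq0 -[pi (f x) == 0]negbK -pi_unit ufx orbF => /eqP.
  by exists z; rewrite dE zE exprSr mulrA.
move=> x y; have [ux|] := boolP (x \is a GRing.unit); first exact: unit_case.
rewrite pi_unit negbK => /eqP px.
(* By additivity the defect of [1 + x] is also that of x. *)
have [|d dE] := unit_case (1 + x) y.
  by rewrite pi_unit rmorphD rmorph1 px addr0 oner_eq0.
exists d; move: dE; rewrite mulrDl mul1r !fD f1 mulrDl mul1r -addrA.
exact: addrI.
Qed.

(** [res_hom] gives level 1, and each step gains one level until [P ^+ n.+1] = 0. Additivity is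
    settled first, as the multiplicative step relies on it. *)
Lemma rel_ring_hom : (forall x y, f (x + y) = f x + f y) /\ (forall x y, f (x * y) = f x * f y).
Proof.
have [_ phiD phiM] := res_hom.
have fD x y : f (x + y) = f x + f y.
  suff /(_ n) : forall j, (j <= n)%N ->
      forall u v, exists d, f (u + v) = f u + f v + P ^+ j.+1 * d.
    by move=> /(_ (leqnn n) x y) [d ->]; rewrite pn0 mul0r addr0.
  elim=> [|j IH] jn u v; last by apply: additive_step => //; apply: IH; apply: ltnW.
  have [|d dE] := @pi_ker (f (u + v) - (f u + f v)).
    by rewrite rmorphB rmorphD phiD subrr.
  by exists d; rewrite expr1 -dE [RHS]addrC subrK.
split=> // x y.
suff /(_ n) : forall j, (j <= n)%N ->
    forall u v, exists d, f (u * v) = f u * f v + P ^+ j.+1 * d.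
  by move=> /(_ (leqnn n) x y) [d ->]; rewrite pn0 mul0r addr0.
elim=> [|j IH] jn u v; last by apply: multiplicative_step => //; apply: IH; apply: ltnW.
have [|d dE] := @pi_ker (f (u * v) - f u * f v).
  by rewrite rmorphB rmorphM phiM subrr.
by exists d; rewrite expr1 -dE [RHS]addrC subrK.
Qed.
End GaloisRing.

(** * From the definition of a Galois ring to its residue map *)

Section LocalRing.
Variable R : finComUnitRingType.

Lemma ideal_sub_maximal (J : {set R}) : is_ideal J -> 1 \notin J ->
  exists2 M, is_maximal_ideal M & J \subset M.
Proof.
(* A boolean form of [is_ideal], so that a maximal set can be extracted by finiteness. *)
pose idealb (I : {set R}) := [&& 0 \in I, [forall x in I, forall y in I, x + y \in I] &
  [forall r, forall x in I, r * x \in I]].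
have idealP I : reflect (is_ideal I) (idealb I).
  apply: (iffP and3P) => [[I0 ID IM]|[I0 ID IM]].
    split=> // [x y Ix Iy|r x Ix].
      by move/forall_inP/(_ x Ix)/forall_inP/(_ y Iy): ID.
    by move/forallP/(_ r)/forall_inP/(_ x Ix): IM.
  split=> //; first by apply/forall_inP => x Ix; apply/forall_inP => y; apply: ID.
  by apply/forallP => r; apply/forall_inP => x; apply: IM.
move=> /idealP idJ J1.
have [M /maxsetP[/andP[idM M1] maxM] JM] :=
  @maxset_exists _ (fun I => idealb I && (1 \notin I)) J (introT andP (conj idJ J1)).
exists M => //; split=> //; first exact/idealP.
move=> I idI MI; have [I1|I1] := boolP (1 \in I); [right | left].
  by apply/setP => x; rewrite inE -[x]mulr1; case: idI => _ _; apply.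
by apply: maxM => //; rewrite I1 andbT; apply/idealP.
Qed.

Lemma local_unit (M : {set R}) : is_maximal_ideal M ->
  (forall M', is_maximal_ideal M' -> M' = M) ->
  forall x, (x \is a GRing.unit) = (x \notin M).
Proof.
move=> [[M0 MD MM] M1 _] uniqM x; apply/idP/idP => [ux|].
  by apply: contra M1 => Mx; rewrite -(mulVr ux) MM.
apply: contraR => nux.
have [||M' /uniqM ->] := @ideal_sub_maximal [set r * x | r : R].
- split; first by apply/imsetP; exists 0; rewrite ?mul0r.
    move=> _ _ /imsetP[a _ ->] /imsetP[b _ ->]; apply/imsetP.
    by exists (a + b); rewrite ?mulrDl.
  by move=> r _ /imsetP[a _ ->]; apply/imsetP; exists (r * a); rewrite ?mulrA.
- apply: contra nux => /imsetP[r _ E]; apply/unitrP; exists r.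
  by rewrite -E mulrC -E.
by move/subsetP; apply; apply/imsetP; exists 1; rewrite ?mul1r.
Qed.

(** By pigeonhole [x ^+ i = x ^+ j] for some i < j, and the factor [1 - x ^+ (j - i)] cancels. *)
Lemma local_nilpotent (x : R) :
  (forall i, (0 < i)%N -> 1 - x ^+ i \is a GRing.unit) -> exists i, x ^+ i == 0.
Proof.
move=> ux; have /injectivePn[i [j nij xij]] : ~~ injectiveb (fun i : 'I_(#|R|.+1) => x ^+ i).
  by apply: contraL (leqnn #|R|) => /injectiveP/leq_card; rewrite card_ord -ltnNge.
wlog ij : i j nij xij / (i < j)%N.
  move=> W; have := nij; rewrite -(inj_eq val_inj) neq_ltn => /orP[|] ij.
    exact: W ij.
  by apply: W ij; rewrite // eq_sym.
exists i; apply/eqP/(mulIr (ux _ (_ : 0 < j - i)%N)); first by rewrite subn_gt0.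
by rewrite mul0r mulrBr mulr1 -exprD subnKC ?(ltnW ij) // xij subrr.
Qed.

Lemma galois_ring_structure : galois_ring R -> odd_characteristic R -> ~ is_field_ring R ->
  exists (p n : nat) (F : finFieldType) (pi : {rmorphism R -> F}),
    [/\ prime p, odd p, (0 < n)%N, (p%:R : R) ^+ n.+1 = 0 & (p%:R : R) ^+ n != 0] /\
    [/\ forall a, exists x, pi x = a, forall x, (x \is a GRing.unit) = (pi x != 0) &
        forall x, pi x = 0 -> exists y, x = p%:R * y].
Proof.
move=> [M [p [maxM uniqM p_pr Mp ME]]] [m [[_ m0 _] m_odd]] nfield.
have [[M0 MD MM] M1 _] := maxM.
have unitM := local_unit maxM uniqM.
have MB x y : x \in M -> y \in M -> x - y \in M.
  by move=> Mx My; rewrite -mulN1r MD ?MM.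
have [F [pi [pi_surj piM]]] := residue_field MB MM unitM.
(* If p = 2, the odd characteristic m gives [1 = - (2 * m./2)], which lies in [M]. *)
have p_odd : odd p.
  case: (even_prime p_pr) => // p2; case/negP: M1.
  have -> : (1 : R) = - (p%:R * (m./2)%:R).
    apply/eqP; rewrite -addr_eq0 p2 -natrM mul2n -[1]/(1%:R) -natrD.
    by have := odd_double_half m; rewrite m_odd => ->; rewrite m0.
  by rewrite -mulrN mulrC MM.
have [i Pi] : exists i, (p%:R : R) ^+ i == 0.
  apply: local_nilpotent => -[//|i] _; rewrite unitM; apply: contra M1 => H.
  by rewrite -[1](subrK ((p%:R : R) ^+ i.+1)) MD // exprSr MM.
(* The least exponent killing p is at least 2: exponent 0 would give 1 = 0, and exponent 1 would
   give M = 0, making [R] a field. *)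
have := ex_intro (fun i => (p%:R : R) ^+ i == 0) i Pi => /ex_minnP[[|[|n]]].
- by rewrite oner_eq0.
- rewrite expr1 => /eqP P0 _; case: nfield => x x0; rewrite unitM.
  by rewrite ME; apply: contra x0 => /imsetP[y _ ->]; rewrite P0 mul0r.
move=> /eqP Pn min; exists p, n.+1, F, pi; split; split=> //.
- by apply/negP => /min; rewrite ltnn.
- by move=> x; rewrite unitM piM.
by move=> x /eqP; rewrite piM ME => /imsetP[y _ ->]; exists y.
Qed.
End LocalRing.

(** * Scheme automorphisms and the equivalence *)

Lemma in_Aut_cyc_rel (R : finComUnitRingType) (K : {group {unit R}}) (f : {perm R}) :
  in_Aut_cyc K f -> forall x y, exists2 k, k \in uset K & f y - f x = (y - x) * k.
Proof.
move=> autf x y.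
have : (f x, f y) \in [set xy : R * R | cyc_rel K (y - x) xy.1 xy.2].
  rewrite -autf; apply/imsetP; exists (x, y) => //; rewrite inE /cyc_rel /=.
  by apply/imsetP; exists 1; rewrite ?uset1 ?mulr1.
by rewrite inE /cyc_rel => /imsetP[k Kk ->]; exists k.
Qed.

(** An injection of a finite relation into itself is onto. *)
Lemma rel_in_Aut_cyc (R : finComUnitRingType) (K : {group {unit R}}) (f : {perm R}) :
  (forall r x y, cyc_rel K r x y -> cyc_rel K r (f x) (f y)) -> in_Aut_cyc K f.
Proof.
move=> relf r; apply/eqP; rewrite eqEcard card_imset ?leqnn ?andbT.
  apply/subsetP => _ /imsetP[[x y] rxy ->]; rewrite !inE /= in rxy *.
  exact: relf.
by move=> [x y] [x' y'] /= [/perm_inj -> /perm_inj ->].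
Qed.

Theorem theorem1p6 (R : finComUnitRingType) (K : {group {unit R}}) :
  galois_ring R -> odd_characteristic R -> ~ is_field_ring R ->
  (cyc_normal K <-> pure K).
Proof.
move=> galR oddR nfieldR.
have [p [n [F [pi [[p_pr p_odd n_gt0 pn0 pn1] [pi_surj pi_unit pi_ker]]]]]] :=
  galois_ring_structure galR oddR nfieldR.
split=> [normK I [I0 ID IM] KI|pureK f autf].
- apply/eqP; rewrite eqEsubset sub1set I0 andbT; apply/subsetP => z0 Iz0.
  rewrite inE; apply/negPn/negP => z0_neq0.
  (* The last nonzero element among the multiples [p%:R ^+ i * z0]. *)
  have [z [Iz z_neq0 pz]] : exists z, [/\ z \in I, z != 0 & p%:R * z = 0].
    have : exists i, (p%:R : R) ^+ i * z0 == 0 by exists n.+1; rewrite pn0 mul0r.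
    case/ex_minnP => [[|i]] /eqP; first by rewrite mul1r => /eqP; rewrite (negPf z0_neq0).
    move=> pz min; exists (p%:R ^+ i * z0); split; first exact: IM.
      by apply/negP => /min; rewrite ltnn.
    by rewrite mulrA -exprS.
  have pi_z : pi z = 0.
    apply/eqP; rewrite -[_ == 0]negbK -pi_unit; apply: contra pn1 => uz.
    have -> : (p%:R : R) = 0 by apply: (mulIr uz); rewrite pz mul0r.
    by rewrite expr0n (gtn_eqF n_gt0).
  have IN x : x \in I -> - x \in I by rewrite -mulN1r; apply: IM.
  pose g x := if pi x == 1 then z else 0.
  have Ig x : g x \in I by rewrite /g; case: ifP.
  have pi_g x : pi (x + g x) = pi x.
    by rewrite rmorphD /g; case: ifP; rewrite ?pi_z ?rmorph0 addr0.
  have f_inj : injective (fun x => x + g x).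
    move=> x y /= E; have := congr1 pi E; rewrite !pi_g => pxy.
    by apply: (addIr (g x)); rewrite E /g pxy.
  have autf : in_Aut_cyc K (perm f_inj).
    apply: rel_in_Aut_cyc => r x y; rewrite /cyc_rel !permE.
    (* For a non-unit r, x and y share a residue and are translated alike. For a unit r, k changes
       by an element of [I], which [KI] absorbs. *)
    move=> /imsetP[k Kk rk]; have [ur|] := boolP (r \is a GRing.unit); last first.
      rewrite pi_unit negbK => /eqP pr; have pxy : pi y = pi x.
        by apply/eqP; rewrite -subr_eq0 -rmorphB rk rmorphM pr mul0r.
      rewrite [X in X \in _](_ : _ = y - x); last by rewrite /g pxy; ring.
      by rewrite rk; apply/imsetP; exists k.
    apply/imsetP; exists (k + r^-1 * (g y - g x)); last first.
      by rewrite mulrDr mulVKr // -rk; ring.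
    by rewrite -KI; apply/imset2P; exists k (r^-1 * (g y - g x)); rewrite // IM ?ID ?IN.
  (* The values at 0 and -1, both fixed because neither has residue 1, force b = 0 and a = 1; the
     value 1 + z at 1 then gives z = 0. *)
  have [a [b [s [_ [_ sD _ s1] fE]]]] := normK _ autf.
  have s0 : s 0 = 0 by apply: (addrI (s 0)); rewrite -sD !addr0.
  have sN1 : s (-1) = -1 by apply/eqP; rewrite -addr_eq0 -{2}s1 -sD addNr s0.
  have two0 := res_two0 p_odd pi_unit pn0.
  have := fE 0; have := fE 1; have := fE (-1).
  rewrite s0 s1 sN1 !permE /g rmorphN rmorph1 rmorph0 eqxx.
  rewrite [0 == 1]eq_sym oner_eq0 eq_sym -subr_eq0 opprK -[1 + 1]/(2%:R).
  rewrite (negPf two0) !addr0 mulr0 add0r mulr1 mulrN1 => Em E1 E0.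
  case/eqP: z_neq0; apply: (addrI 1); rewrite E1 -E0 !addr0.
  by apply: oppr_inj; rewrite Em -E0 addr0.
have fK := in_Aut_cyc_rel autf.
have [u Ku uE] := fK 0 1; have uu := uset_unit Ku.
rewrite subr0 mul1r in uE.
(* Normalizing by u in [K] keeps the relation with [K] and makes the map fix 0 and 1. *)
pose s x := (f x - f 0) / u.
have sK x y : exists2 k, k \in uset K & s y - s x = (y - x) * k.
  have [k Kk kE] := fK x y; exists (k / u); first by rewrite usetM ?usetV.
  by rewrite mulrA -kE /s -mulrBl; congr (_ / _); ring.
have s0 : s 0 = 0 by rewrite /s subrr mul0r.
have s1 : s 1 = 1 by rewrite /s uE divrr.
have [sD sM] := rel_ring_hom p_pr p_odd n_gt0 pi_surj pi_unit pi_ker pn0 pn1 pureK sK s0 s1.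
exists u, (f 0), s; split=> // [|x]; last by rewrite /s mulrC divrK // subrK.
split=> //; exact: injF_bij (rel_inj sK).
Qed.
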